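(* Let $\mathbf{x}=(x_1,x_2,\dots)$ and $\mathbf{y}=(y_1,y_2,\dots)$ be elements of $\ell^1(\mathbb{Z}_2)$. If $$\sum_{j\ge1}\frac{(\mathbf{x}+\mathbf{y})_j}{j+1}=\sum_{j\ge1}\frac{x_j}{j+1}+\sum_{j\ge1}\frac{y_j}{j+1},$$ then the point $(a,b)$ with $a=\sum_{j\ge1}x_j2^{-j}$ and $b=\sum_{j\ge1}y_j2^{-j}$ (i.e. $a=[0.x_1x_2\dots]_2$, $b=[0.y_1y_2\dots]_2$) lies in the Sierpinski triangle $S_T$.
   Context: $\ell^1(\mathbb{Z}_2)$ is the set of sequences with entries in $\{0,1\}$ having only finitely many nonzero entries, with addition componentwise modulo $2$. The Sierpinski triangle $S_T$ is defined as follows: $T_0=\{(x,y)\in[0,1]\times[0,1]: 0\le x+y\le1\}$ (the closed triangle with vertices $(0,0),(1,0),(0,1)$); $S_0=T_0$; for $j\ge0$, letting $S_j'=\tfrac12 S_j$ be the scaled copy of $S_j$, $v=(\tfrac12,0)$, $w=(0,\tfrac12)$, set $S_{j+1}=S_j'\cup(S_j'+v)\cup(S_j'+w)$; and $S_T=\bigcap_{j\ge0}S_j$. *)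

(* Defs.v *)
From HB Require Import structures.
From mathcomp Require Import all_boot all_order all_algebra.
From mathcomp Require Import all_classical all_reals topology normedtype sequences.
Set Implicit Arguments.
Unset Strict Implicit.
Unset Printing Implicit Defensive.
Import Order.TTheory GRing.Theory Num.Theory.
Import numFieldNormedType.Exports.
Local Open Scope classical_set_scope.
Local Open Scope ring_scope.

(* Sequences are indexed from 0: [x j] is the entry usually written x_(j+1).
   Addition is the pointwise one of [nat -> 'Z_2], that is, modulo 2. *)
Definition l1_Z2 : set (nat -> 'Z_2) :=
  [set x | finite_set [set j | x j != 0]].

Section Defs.
Variable R : realType.

(* The real number 0 or 1 corresponding to a residue; this is not additive. *)
Definition digit (c : 'Z_2) : R := (c : nat)%:R.

(* sum_(j >= 1) x_j / (j + 1), with the index shifted as above. *)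
Definition weight (x : nat -> 'Z_2) : R :=
  limn (series (fun j => digit (x j) / j.+2%:R)).

(* [0.x_1 x_2 ...]_2 = sum_(j >= 1) x_j 2^-j, with the index shifted. *)
Definition binary (x : nat -> 'Z_2) : R :=
  limn (series (fun j => digit (x j) * 2 ^- j.+1)).

Definition triangle0 : set (R * R) :=
  [set p | [/\ 0 <= p.1 <= 1, 0 <= p.2 <= 1 & 0 <= p.1 + p.2 <= 1]].

Definition halve (S : set (R * R)) : set (R * R) :=
  [set (p.1 / 2, p.2 / 2) | p in S].

Definition translate (v : R * R) (S : set (R * R)) : set (R * R) :=
  [set p + v | p in S].

Fixpoint sierpinski_step (j : nat) : set (R * R) :=
  if j is i.+1 then
    let S' := halve (sierpinski_step i) in
    S' `|` translate (2^-1, 0) S' `|` translate (0, 2^-1) S'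
  else triangle0.

Definition sierpinski : set (R * R) :=
  \bigcap_(j in [set: nat]) sierpinski_step j.

End Defs.

(* Main.v *)
Require Import Defs.
From HB Require Import structures.
From mathcomp Require Import all_boot all_order all_algebra.
From mathcomp Require Import all_classical all_reals topology normedtype sequences.
From mathcomp Require Import ring lra.
Set Implicit Arguments.
Unset Strict Implicit.
Unset Printing Implicit Defensive.
Import Order.TTheory GRing.Theory Num.Theory.
Import numFieldNormedType.Exports.
Local Open Scope classical_set_scope.
Local Open Scope ring_scope.

(** Writing + for addition of real digits, (x + y)_j = x_j + y_j - 2 x_j y_j, so
the hypothesis says that a sum of nonnegative terms 2 x_j y_j / (j + 1) vanishes:
the supports of x and y are disjoint.  The leading digits (x_1, y_1) are then
(0,0), (1,0) or (0,1), which selects one of the three half-size copies, and the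
shifted sequences again have disjoint supports. *)

(** The partial sums are constant from [N] on. This turns [weight] and [binary] of finitely
    supported sequences into finite sums. *)
Lemma limn_series_eventually0 (R : realType) (f : R^nat) (N : nat) :
  (forall j, (N <= j)%N -> f j = 0) -> limn (series f) = \sum_(0 <= j < N) f j.
Proof.
move=> f0; apply: lim_near_cst => //; exists N => // n /= leNn.
rewrite /series /= (big_cat_nat (leq0n N) leNn) //= [X in _ + X]big_nat [X in _ + X]big1 ?addr0//.
by move=> j /andP[/f0].
Qed.

Lemma l1_Z2_eventually0 (x : nat -> 'Z_2) : l1_Z2 x ->
  exists N, forall j, (N <= j)%N -> x j = 0.
Proof.
move=> /finite_seqP[s xs]; exists (\max_(i <- s) i).+1 => j Nj.
apply: contrapT => /eqP xj.
have js : [set` s] j by rewrite -xs.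
by move: Nj; rewrite ltnNge (leq_bigmax_seq j).
Qed.

Lemma Z2_cases (c : 'Z_2) : c = 0 \/ c = 1.
Proof. by case: c => -[|[|//]] i; [left|right]; apply: val_inj. Qed.

Lemma digit0 (R : realType) : digit R 0 = 0. Proof. by []. Qed.

Lemma digit1 (R : realType) : digit R 1 = 1. Proof. by []. Qed.

Lemma digit_ge0 (R : realType) (c : 'Z_2) : 0 <= digit R c.
Proof. exact: ler0n. Qed.

(** Addition modulo 2 drops a carry of 2 exactly when both digits are 1, and the product detects
    that case. *)
Lemma digitD (R : realType) (c d : 'Z_2) :
  digit R (c + d) = digit R c + digit R d - 2 * (digit R c * digit R d).
Proof.
have dd : digit R (1 + 1) = 0 by [].
case: (Z2_cases c) => ->; case: (Z2_cases d) => ->;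
  by rewrite ?add0r ?addr0 ?dd ?digit0 ?digit1; ring.
Qed.

Definition disjoint_digits (x y : nat -> 'Z_2) :=
  forall j, x j = 0 \/ y j = 0.

Lemma weightD_disjoint (R : realType) (x y : nat -> 'Z_2) :
  l1_Z2 x -> l1_Z2 y -> weight R (x + y) = weight R x + weight R y ->
  disjoint_digits x y.
Proof.
move=> /l1_Z2_eventually0[N xN] /l1_Z2_eventually0[M yM].
have xyE j : (x + y) j = x j + y j by [].
(* A common bound truncates all three series at the same length, so that they can be compared term
   by term. *)
pose K := maxn N M.
have xK j : (K <= j)%N -> x j = 0 by rewrite geq_max => /andP[/xN].
have yK j : (K <= j)%N -> y j = 0 by rewrite geq_max => /andP[_ /yM].
rewrite /weight !(@limn_series_eventually0 _ _ K); first last.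
- by move=> j Kj; rewrite xyE xK// yK// addr0 digit0 mul0r.
- by move=> j Kj; rewrite xK// digit0 mul0r.
- by move=> j Kj; rewrite yK// digit0 mul0r.
pose p j : R := digit R (x j) * digit R (y j) / j.+2%:R.
under eq_bigr => j _ do
  rewrite xyE digitD 2!mulrDl mulNr -mulrA -/(p j).
rewrite sumrB big_split /= -mulr_sumr => /eqP.
(* The two weights cancel, leaving twice the sum of the [p j] equal to 0. *)
rewrite -subr_eq0 addrAC subrr sub0r oppr_eq0 mulf_eq0 pnatr_eq0 /= big_mkord.
have p_ge0 j : 0 <= p j by rewrite /p divr_ge0 ?ler0n ?mulr_ge0 ?digit_ge0.
rewrite psumr_eq0// => /allP p0 j.
case: (ltnP j K) => [jK|/xK]; last by left.
have /= := p0 (Ordinal jK) (mem_index_enum _).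
rewrite /p !mulf_eq0 invr_eq0 [_.+2%:R == 0]pnatr_eq0 orbF.
case: (Z2_cases (x j)) => ->; first by left.
by case: (Z2_cases (y j)) => ->; [right | rewrite digit1 oner_eq0].
Qed.

Lemma digitD_le1 (R : realType) (c d : 'Z_2) : c = 0 \/ d = 0 ->
  digit R c + digit R d <= 1.
Proof.
case: (Z2_cases c) => ->; case: (Z2_cases d) => -> h;
  rewrite ?digit0 ?digit1 ?addr0 ?add0r ?ler01 //.
by case: h.
Qed.

Definition binary_trunc (R : realType) (N : nat) (x : nat -> 'Z_2) : R :=
  \sum_(0 <= j < N) digit R (x j) * 2 ^- j.+1.

(** Shifting the digits doubles the tail; the leading digit contributes the translation by 0 or
    1/2. *)
Lemma binary_truncS (R : realType) (N : nat) (x : nat -> 'Z_2) :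
  binary_trunc R N.+1 x =
  binary_trunc R N (x \o S) / 2 + digit R (x 0) / 2.
Proof.
rewrite /binary_trunc big_nat_recl// addrC expr1; congr (_ + _).
by rewrite mulr_suml; apply: eq_bigr => j _; rewrite exprSr invfM mulrA mulrAC.
Qed.

Lemma binary_trunc_ge0 (R : realType) (N : nat) (x : nat -> 'Z_2) :
  0 <= binary_trunc R N x.
Proof. by apply: sumr_ge0 => j _; rewrite mulr_ge0 ?digit_ge0 ?invr_ge0 ?exprn_ge0. Qed.

Lemma binary_truncD_le1 (R : realType) (N : nat) (x y : nat -> 'Z_2) :
  disjoint_digits x y -> binary_trunc R N x + binary_trunc R N y <= 1.
Proof.
elim: N x y => [|N IH] x y xy.
  by rewrite /binary_trunc !big_geq// addr0 ler01.
have := IH _ _ (fun j => xy j.+1); have := digitD_le1 R (xy 0).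
by rewrite !binary_truncS; lra.
Qed.

(** Each level of the construction consumes one digit, so the induction on [n] must leave [N], [x]
    and [y] free. *)
Lemma binary_trunc_step (R : realType) (n N : nat) (x y : nat -> 'Z_2) :
  disjoint_digits x y ->
  sierpinski_step n (binary_trunc R N x, binary_trunc R N y).
Proof.
elim: n N x y => [|n IH] N x y xy.
  have := binary_truncD_le1 R N xy.
  have := binary_trunc_ge0 R N x; have := binary_trunc_ge0 R N y.
  by rewrite /= /triangle0 /= => *; split => /=; lra.
case: N => [|N].
  (* With no digits left the point is the origin, which is its own half and so stays in the
     untranslated copy. *)
  left; left; exists (binary_trunc R 0 x, binary_trunc R 0 y); first exact: IH.
  by rewrite /binary_trunc /= !big_geq// mul0r.
rewrite !binary_truncS.
set a := binary_trunc R N _; set b := binary_trunc R N _.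
have ab : halve (sierpinski_step n) (a / 2, b / 2).
  by exists (a, b) => //; apply: IH => j; exact: xy.
have := xy 0.
case: (Z2_cases (x 0)) => ->; case: (Z2_cases (y 0)) => -> h;
  rewrite ?digit0 ?digit1 ?mul0r ?mul1r ?addr0.
- by left; left.
- by right; exists (a / 2, b / 2) => //; congr pair; rewrite /= ?addr0.
- by left; right; exists (a / 2, b / 2) => //; congr pair; rewrite /= ?addr0.
- by case: h.
Qed.

Theorem theorem3p1 (R : realType) (x y : nat -> 'Z_2)
    (hx : l1_Z2 x) (hy : l1_Z2 y)
    (hxy : weight R (x + y) = weight R x + weight R y) :
  sierpinski (binary R x, binary R y).
Proof.
have xy := weightD_disjoint hx hy hxy.
have [N xN] := l1_Z2_eventually0 hx; have [M yM] := l1_Z2_eventually0 hy.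
(* The truncation length depends only on the supports, so one choice serves every level [n]. *)
move=> n _; rewrite /binary !(@limn_series_eventually0 _ _ (maxn N M)).
- exact: binary_trunc_step.
- by move=> j; rewrite geq_max => /andP[_ /yM ->]; rewrite digit0 mul0r.
- by move=> j; rewrite geq_max => /andP[/xN -> _]; rewrite digit0 mul0r.
Qed.
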